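(* Let $\kappa=0.9214$ and $H(s)=\int_s^\infty h(t-1)\,dt$ for $s\geqslant2$. Then $H(s)\leqslant\kappa sh(s)$ for $s\geqslant 3$, and $H(3)\leqslant\kappa sh(s)$ for $1\leqslant s\leqslant 3$.
   Context: $h(s)=e^{-2}$ for $1\leqslant s\leqslant 2$, $h(s)=e^{-s}$ for $2\leqslant s\leqslant 3$, $h(s)=3s^{-1}e^{-s}$ for $s\geqslant3$. *)

(* Defs.v *)
From Stdlib Require Import Reals.
From Coquelicot Require Import Coquelicot.
Open Scope R_scope.

Definition kappa : R := 0.9214.

(* Meaningful only for 1 <= s; the value e^{-2} for s < 1 is an arbitrary
   totalization.  The formulas agree at the breakpoints s = 2 and s = 3. *)
Definition h (s : R) : R :=
  if Rle_dec s 2 then exp (- 2)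
  else if Rle_dec s 3 then exp (- s)
  else 3 * / s * exp (- s).

(* Meaningful only for 2 <= s, where t - 1 >= 1 on the range of integration.
   [RInt_gen] is total and says nothing when the integral diverges, so
   convergence has to be asserted separately, with [ex_RInt_gen]. *)
Definition H (s : R) : R :=
  RInt_gen (fun t : R => h (t - 1)) (at_point s) (Rbar_locally p_infty).

(* Main.v *)
(** Since [h u <= exp (- u)], the tail satisfies [H s <= exp (1 - s)], which
    gives convergence and, because [e <= 3 kappa], the bound for [s >= 3].
    For [1 <= s <= 3] the minimum of [s h(s)] is [exp (-2)], at [s = 1], and
    [H 3 = exp (-2) - exp (-3) + 3 E_1(3)] has to be compared with
    [kappa exp (-2)]; the two differ by [4e-5] in relative size.  A convergent
    of the Stieltjes continued fraction of [exp x * E_1(x)] and a Padé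
    approximant of [exp] at [1] are sharp enough. *)
Require Import Defs.
From Stdlib Require Import Reals Lra.
From Coquelicot Require Import Coquelicot.
Open Scope R_scope.

(** * Integral comparison and convergence on half-lines *)

Lemma nondecreasing_of_derive_ge0 (f df : R -> R) (a b : R) :
  a <= b ->
  (forall x, a <= x <= b -> is_derive f x (df x)) ->
  (forall x, a <= x <= b -> 0 <= df x) ->
  f a <= f b.
Proof.
intros Hab Hd Hpos.
destruct (MVT_gen f a b df) as [c [Hc Heq]].
- intros x Hx; rewrite Rmin_left, Rmax_right in Hx by lra; apply Hd; lra.
- intros x Hx; rewrite Rmin_left, Rmax_right in Hx by lra.
  apply continuity_pt_filterlim, (ex_derive_continuous f).
  exists (df x); apply Hd; lra.
- rewrite Rmin_left, Rmax_right in Hc by lra.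
  specialize (Hpos c Hc); nra.
Qed.

Lemma ex_RInt_of_continuous (f : R -> R) (a b : R) :
  (forall x, continuous f x) -> ex_RInt f a b.
Proof. intros Hf; apply (ex_RInt_continuous f); intros; apply Hf. Qed.

(** The function [- G x - RInt f a x] has derivative [- dG x - f x >= 0], hence is nondecreasing.
    Arguing this way, rather than integrating [dG], requires no integrability of [dG]. *)
Lemma RInt_le_of_le_opp_derive (f G dG : R -> R) (a b : R) :
  a <= b ->
  (forall x, continuous f x) ->
  (forall x, a <= x <= b -> is_derive G x (dG x)) ->
  (forall x, a <= x <= b -> f x <= - dG x) ->
  RInt f a b <= G a - G b.
Proof.
intros Hab Hf HG Hle.
assert (Hmono : - G a - RInt f a a <= - G b - RInt f a b).
{ apply (nondecreasing_of_derive_ge0 (fun x => - G x - RInt f a x)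
           (fun x => - dG x - f x)); [exact Hab | |].
  - intros x Hx; apply (is_derive_minus (fun x => - G x) (RInt f a)).
    + apply (is_derive_opp G), HG, Hx.
    + apply (is_derive_RInt f (RInt f a) a x); [| apply Hf].
      apply filter_forall; intros y; apply (RInt_correct f).
      now apply ex_RInt_of_continuous.
  - intros x Hx; specialize (Hle x Hx); lra. }
rewrite RInt_point in Hmono; change (@zero R_CompleteNormedModule) with 0 in Hmono.
lra.
Qed.

(** Partial integrals of a nonnegative function increase with the upper endpoint, so they converge
    to their supremum. The bound is asked only from [c] on, so that an integral can first be split
    at [c]. *)
Lemma is_RInt_gen_of_bounded (f : R -> R) (a c M : R) :
  a <= c ->
  (forall x, continuous f x) ->
  (forall x, 0 <= f x) ->
  (forall b, c <= b -> RInt f a b <= M) ->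
  exists l, is_RInt_gen f (at_point a) (Rbar_locally p_infty) l /\ l <= M.
Proof.
intros Hac Hf Hpos HM.
assert (Hex : forall x y, ex_RInt f x y)
  by (intros; now apply ex_RInt_of_continuous).
assert (Hmono : forall x y, x <= y -> RInt f a x <= RInt f a y).
{ intros x y Hxy.
  rewrite <- (RInt_Chasles f a x y) by apply Hex.
  assert (0 <= RInt f x y) by (apply RInt_ge_0; auto).
  change plus with Rplus; lra. }
destruct (completeness (fun v => exists b, c <= b /\ v = RInt f a b)) as [l [Hub Hlub]].
- exists M; intros v [b [Hb ->]]; auto.
- exists (RInt f a c), c; split; [lra | reflexivity].
- exists l; split.
  + apply filterlimi_locally; intros eps.
    assert (Hb : exists b, c <= b /\ l - eps < RInt f a b).
    { apply Classical_Prop.NNPP; intros Hn.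
      assert (l <= l - eps); [| destruct eps; simpl in *; lra].
      apply Hlub; intros v [b [Hb ->]].
      apply Rnot_lt_le; intros Hlt; apply Hn; now exists b. }
    destruct Hb as [b [Hcb Hb]].
    apply Filter_prod with (fun x => x = a) (fun x => b < x).
    * reflexivity.
    * now exists b.
    * intros x y -> Hy; exists (RInt f a y); split; [now apply (RInt_correct f) |].
      assert (RInt f a y <= l) by (apply Hub; exists y; split; [lra | reflexivity]).
      assert (RInt f a b <= RInt f a y) by (apply Hmono; lra).
      change (Rabs (RInt f a y - l) < eps).
      apply Rabs_def1; destruct eps; simpl in *; lra.
  + apply Hlub; intros v [b [Hb ->]]; auto.
Qed.

Lemma RInt_gen_le_of_bounded (f : R -> R) (a c M : R) :
  a <= c ->
  (forall x, continuous f x) ->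
  (forall x, 0 <= f x) ->
  (forall b, c <= b -> RInt f a b <= M) ->
  RInt_gen f (at_point a) (Rbar_locally p_infty) <= M.
Proof.
intros Hac Hf Hpos HM.
destruct (is_RInt_gen_of_bounded f a c M) as [l [Hl HlM]]; auto.
now rewrite (is_RInt_gen_unique f l Hl).
Qed.

(** * Continuity and bounds for [h] *)

(** Clamping the rational factor at 3 and the exponential at 2 merges the three branches, so
    continuity and bounds need no gluing at the breakpoints. *)
Lemma h_Rmax (s : R) : h s = 3 / Rmax 3 s * exp (- Rmax 2 s).
Proof.
unfold h; destruct (Rle_dec s 2); [| destruct (Rle_dec s 3)].
- rewrite !Rmax_left by lra; replace (Ropp 2) with (-2) by ring; field.
- rewrite Rmax_left, Rmax_right by lra; field.
- rewrite !Rmax_right by lra; field; lra.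
Qed.

Lemma h_pos (s : R) : 0 < h s.
Proof.
rewrite h_Rmax; apply Rmult_lt_0_compat; [| apply exp_pos].
assert (3 <= Rmax 3 s) by apply Rmax_l; apply Rdiv_lt_0_compat; lra.
Qed.

Lemma h_le_exp (s : R) : h s <= exp (- s).
Proof.
rewrite h_Rmax, <- (Rmult_1_l (exp (- s))).
assert (3 <= Rmax 3 s) by apply Rmax_l.
assert (s <= Rmax 2 s) by apply Rmax_r.
apply Rmult_le_compat; [left; apply Rdiv_lt_0_compat; lra | left; apply exp_pos | |].
- apply Rle_div_l; lra.
- destruct (Req_dec s (Rmax 2 s)) as [<- | Hne]; [apply Rle_refl |].
  left; apply exp_increasing; lra.
Qed.

Lemma h_ge3 (s : R) : 3 <= s -> h s = 3 / s * exp (- s).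
Proof. intros Hs; rewrite h_Rmax, !Rmax_right by lra; reflexivity. Qed.

Lemma continuous_Rmax (c x : R) : continuous (Rmax c) x.
Proof.
apply continuous_ext with (fun y => (c + y + Rabs (c - y)) / 2).
- intros y; unfold Rmax, Rabs; destruct Rle_dec, Rcase_abs; lra.
- apply (continuous_scal_l (fun y => c + y + Rabs (c - y)) (/ 2)).
  apply (continuous_plus (fun y => c + y)).
  + apply (ex_derive_continuous (fun y => c + y)); auto_derive; auto.
  + apply (continuous_comp (fun y => c - y) Rabs).
    * apply (ex_derive_continuous (fun y => c - y)); auto_derive; auto.
    * apply continuous_Rabs.
Qed.

Lemma continuous_h (s : R) : continuous h s.
Proof.
apply continuous_ext with (fun s => 3 / Rmax 3 s * exp (- Rmax 2 s)).
- intros y; symmetry; apply h_Rmax.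
- apply (continuous_mult (fun s => 3 / Rmax 3 s) (fun s => exp (- Rmax 2 s))).
  + apply (continuous_comp (Rmax 3) (fun y => 3 / y)); [apply continuous_Rmax |].
    apply (ex_derive_continuous (fun y => 3 / y)); auto_derive.
    assert (3 <= Rmax 3 s) by apply Rmax_l; lra.
  + apply (continuous_comp (Rmax 2) (fun y => exp (- y))); [apply continuous_Rmax |].
    apply (ex_derive_continuous (fun y => exp (- y))); auto_derive; auto.
Qed.

(** * Integrals of the shifted [h] *)

Lemma continuous_h_shift (t : R) : continuous (fun t => h (t - 1)) t.
Proof.
apply (continuous_comp (fun t => t - 1) h); [| apply continuous_h].
apply (ex_derive_continuous (fun t => t - 1)); auto_derive; auto.
Qed.

(** Integrates [h_le_exp]. Nothing is lost on [[3, 4]], where [h (t - 1)] equals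
    [exp (- (t - 1))]. *)
Lemma RInt_h_shift_le (a b : R) :
  a <= b -> RInt (fun t => h (t - 1)) a b <= exp (- (a - 1)) - exp (- (b - 1)).
Proof.
intros Hab.
apply (RInt_le_of_le_opp_derive _ (fun t => exp (- (t - 1)))
         (fun t => - exp (- (t - 1)))); auto.
- apply continuous_h_shift.
- intros x _; auto_derive; [auto | unfold Rminus; ring].
- intros x _; rewrite Ropp_involutive; apply h_le_exp.
Qed.

(** The ninth convergent of Stieltjes' continued fraction
    [1/(x + 1/(1 + 1/(x + 2/(1 + 2/(x + ...)))))] of [exp x * E_1(x)]; the
    convergents of odd order are upper bounds. *)
Definition E1_convergent (x : R) : R :=
  (24 + 154 * x + 102 * x ^ 2 + 19 * x ^ 3 + x ^ 4) /
  (x * (120 + 240 * x + 120 * x ^ 2 + 20 * x ^ 3 + x ^ 4)).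

(** With [C] the convergent and [D] the quartic factor of its denominator,
    [C' - C = - 1 / x - 2880 / (x * D x) ^ 2], where [2880 = 4! * 5!]. Since the last term is
    negative, [- G'] dominates the integrand, with [x = t - 1]. *)
Lemma RInt_h_shift_tail_le (b : R) :
  4 <= b ->
  RInt (fun t => h (t - 1)) 4 b <= 3 * E1_convergent 3 * exp (- 3).
Proof.
intros Hb.
set (D := fun x => 120 + 240 * x + 120 * x ^ 2 + 20 * x ^ 3 + x ^ 4).
assert (HD : forall x, 0 < x -> 0 < D x).
{ intros x Hx; unfold D.
  assert (0 < x ^ 2 /\ 0 < x ^ 3 /\ 0 < x ^ 4) by (repeat split; now apply pow_lt).
  lra. }
set (G := fun t => 3 * E1_convergent (t - 1) * exp (- (t - 1))).
assert (HG : RInt (fun t => h (t - 1)) 4 b <= G 4 - G b).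
{ apply (RInt_le_of_le_opp_derive _ G (fun t =>
    - (3 / (t - 1) + 3 * 2880 / ((t - 1) * D (t - 1)) ^ 2) * exp (- (t - 1)))).
  - exact Hb.
  - apply continuous_h_shift.
  - intros t Ht; unfold G, E1_convergent.
    assert (HDt := HD (t - 1) ltac:(lra)); unfold D in *.
    auto_derive.
    + apply Rgt_not_eq, Rmult_lt_0_compat; [lra | exact HDt].
    + change (t + Ropp 1) with (t - 1); field; split; lra.
  - intros t Ht; rewrite h_ge3 by lra.
    assert (HDt := HD (t - 1) ltac:(lra)).
    rewrite Ropp_mult_distr_l, Ropp_involutive.
    apply Rmult_le_compat_r; [left; apply exp_pos |].
    assert (0 < 3 * 2880 / ((t - 1) * D (t - 1)) ^ 2); [| lra].
    apply Rdiv_lt_0_compat; [lra |].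
    now apply pow_lt, Rmult_lt_0_compat; [lra |]. }
assert (0 < G b).
{ unfold G, E1_convergent.
  assert (HDb := HD (b - 1) ltac:(lra)); unfold D in HDb.
  assert (0 < (b - 1) ^ 2 /\ 0 < (b - 1) ^ 3 /\ 0 < (b - 1) ^ 4)
    by (repeat split; apply pow_lt; lra).
  apply Rmult_lt_0_compat; [| apply exp_pos].
  apply Rmult_lt_0_compat; [lra |].
  apply Rdiv_lt_0_compat; [lra |].
  apply Rmult_lt_0_compat; lra. }
unfold G in HG at 1.
replace (- (4 - 1)) with (- 3) in HG by ring; replace (4 - 1) with 3 in HG by ring.
lra.
Qed.

(** * Numerical bounds *)

Lemma exp_1_le : exp 1 <= 193 / 71.
Proof.
(* [N x / N (- x)] is the [3/3] Padé approximant of [exp x]. *)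
set (N := fun x => 120 + 60 * x + 12 * x ^ 2 + x ^ 3).
assert (HN : forall x, 0 <= x <= 1 -> 0 < N (- x)) by (intros x Hx; unfold N; nra).
set (f := fun x => N x / N (- x) * exp (- x)).
assert (Hmono : f 0 <= f 1).
(* The numerator of the derivative is [N'(x) N(-x) + N(x) N'(-x) - N(x) N(-x)]. It has degree 6, and
   contact of order 7 between the approximant and [exp] at 0 cancels everything below [x ^ 6]. *)
{ apply (nondecreasing_of_derive_ge0 f
           (fun x => x ^ 6 / N (- x) ^ 2 * exp (- x))); [lra | |].
  - intros x Hx; assert (H0 := HN x Hx); unfold f, N in *.
    auto_derive; [lra | field; lra].
  - intros x Hx; apply Rmult_le_pos; [| left; apply exp_pos].
    apply Rdiv_le_0_compat; [apply pow_le; lra | apply pow_lt, HN, Hx]. }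
unfold f in Hmono; rewrite Ropp_0, exp_0, exp_Ropp in Hmono.
replace (N 0 / N 0) with 1 in Hmono by (unfold N; field).
replace (N 1 / N (Ropp 1)) with (193 / 71) in Hmono by (unfold N; field).
assert (He := exp_pos 1).
apply (Rmult_le_reg_r (/ exp 1)); [now apply Rinv_0_lt_compat |].
rewrite Rinv_r; lra.
Qed.

Lemma exp_2_eq : exp (- 2) = exp (- 3) * exp 1.
Proof. rewrite <- exp_plus; f_equal; ring. Qed.

Lemma H_3_le : H 3 <= kappa * exp (- 2).
Proof.
apply Rle_trans with
  (exp (- 2) - exp (- 3) + 3 * E1_convergent 3 * exp (- 3)).
- apply (RInt_gen_le_of_bounded (fun t => h (t - 1)) 3 4);
    [lra | apply continuous_h_shift | intros; left; apply h_pos |].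
  intros b Hb.
  rewrite <- (RInt_Chasles (fun t => h (t - 1)) 3 4 b)
    by (apply ex_RInt_of_continuous, continuous_h_shift).
  assert (H1 := RInt_h_shift_le 3 4 ltac:(lra)).
  replace (- (3 - 1)) with (- 2) in H1 by ring.
  replace (- (4 - 1)) with (- 3) in H1 by ring.
  assert (H2 := RInt_h_shift_tail_le b Hb).
  change plus with Rplus; lra.
(* Divided by [exp (- 3)], the claim is [(1 - kappa) * exp 1 <= 1 - 3 * E1_convergent 3 = 181 /
   847], that is, [exp 1 <= 2.7187...], while [193 / 71 = 2.7183...]. *)
- rewrite exp_2_eq; unfold kappa, E1_convergent.
  assert (He := exp_1_le); assert (H3 := exp_pos (- 3)).
  nra.
Qed.

Lemma exp_m2_le_mul_h (s : R) : 1 <= s <= 3 -> exp (- 2) <= s * h s.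
Proof.
intros Hs; unfold h; destruct (Rle_dec s 2) as [H2 | H2].
- assert (H0 := exp_pos (- 2)); nra.
- destruct (Rle_dec s 3) as [_ | H3]; [| lra].
  (* [s exp (3 - s) >= s (4 - s) >= 3 >= e] *)
  replace (exp (- s)) with (exp (- 3) * exp (3 - s))
    by (rewrite <- exp_plus; f_equal; ring).
  rewrite exp_2_eq.
  assert (H0 := exp_pos (- 3)).
  assert (He := exp_1_le).
  assert (H1 := exp_ineq1_le (3 - s)).
  assert (3 <= s * exp (3 - s)) by nra.
  nra.
Qed.

Theorem theorem10 :
  (forall s : R, 2 <= s ->
     ex_RInt_gen (fun t : R => h (t - 1)) (at_point s) (Rbar_locally p_infty)) /\
  (forall s : R, 3 <= s -> H s <= kappa * s * h s) /\
  (forall s : R, 1 <= s <= 3 -> H 3 <= kappa * s * h s).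
Proof.
assert (Hb : forall s b, s <= b ->
  RInt (fun t => h (t - 1)) s b <= exp (- (s - 1))).
{ intros s b Hsb; assert (H0 := RInt_h_shift_le s b Hsb).
  assert (H1 := exp_pos (- (b - 1))); lra. }
assert (Hpos : forall t, 0 <= h (t - 1)) by (intros; left; apply h_pos).
split; [| split].
- intros s _.
  destruct (is_RInt_gen_of_bounded (fun t => h (t - 1)) s s (exp (- (s - 1))))
    as [l [Hl _]]; [lra | apply continuous_h_shift | exact Hpos | apply Hb |].
  now exists l.
- intros s Hs; apply Rle_trans with (exp (- (s - 1))).
  + apply (RInt_gen_le_of_bounded _ s s);
      [lra | apply continuous_h_shift | exact Hpos | apply Hb].
  + rewrite h_ge3 by exact Hs.
    replace (- (s - 1)) with (1 + - s) by ring; rewrite exp_plus.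
    replace (kappa * s * (3 / s * exp (- s))) with (3 * kappa * exp (- s))
      by (field; lra).
    apply Rmult_le_compat_r; [left; apply exp_pos |].
    assert (He := exp_1_le); unfold kappa; lra.
- intros s Hs; apply Rle_trans with (1 := H_3_le).
  rewrite Rmult_assoc; apply Rmult_le_compat_l; [unfold kappa; lra |].
  now apply exp_m2_le_mul_h.
Qed.
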